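(* Let $\mathcal T$ be a Galton–Watson tree with offspring distribution $\xi$, and assume $P(\xi=0)>0$ and $P(\xi>1)>0$. Suppose that $n\to\infty$ with $n\equiv1\pmod{\mathrm{span}(\xi)}$, and let $\tau$ be the unique number in $[0,\rho]$ with $\Psi(\tau)=1$ if $\nu\ge1$, and $\tau=\rho$ if $\nu<1$ (all computed for the weight sequence $w_k=P(\xi=k)$). Then $$\frac1n\log P(|\mathcal T|=n)\to\log\Phi(\tau)-\log\tau=\log\inf_{0\le t<\infty}\frac{\Phi(t)}{t}\in(-\infty,0].$$ If $E\xi=1$, or if $E\xi<1$ and $\rho=1$, then the limit is $0$; otherwise it is strictly negative. In other words, $P(|\mathcal T|=n)$ decays exponentially fast in the supercritical case (then $\tau<1$) and in the subcritical case with $\rho>1$ (then $\tau>1$), but only subexponentially in the critical case and in the subcritical case with $\rho=1$ (then $\tau=1$).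
   Context: $\Phi(t)=E t^\xi=\sum_kP(\xi=k)t^k$, $\rho\in[1,\infty]$ its radius of convergence; for $t$ with $\Phi(t)<\infty$, $\Psi(t)=t\Phi'(t)/\Phi(t)$; if $\Phi(\rho)=\infty$, $\Psi(\rho)=\lim_{t\uparrow\rho}\Psi(t)$; $\nu=\Psi(\rho)$. $\mathrm{span}(\xi)$ is the largest $d$ dividing every $k$ with $P(\xi=k)>0$. A Galton–Watson tree is the family tree in which each node independently has a number of children distributed as $\xi$; $|\mathcal T|$ is its number of nodes. *)

(* Defs.v *)
From HB Require Import structures.
From mathcomp Require Import all_boot all_order all_algebra.
From mathcomp Require Import all_classical all_reals all_analysis.
Set Implicit Arguments. Unset Strict Implicit. Unset Printing Implicit Defensive.
Import Order.TTheory GRing.Theory Num.Theory.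
Import numFieldNormedType.Exports.
Local Open Scope classical_set_scope.
Local Open Scope ring_scope.

Section GW.
Variable R : realType.
Variable p : nat -> R. (* p k = P(xi = k) *)

(* Law of the total size |T| of a Galton-Watson tree with offspring law p.
   [gw_tp fuel m] = P(|T| = m), valid whenever m <= fuel:
   the root has k children with probability p k, and the k subtrees are
   i.i.d. copies of T; [forest k m] = P(k i.i.d. copies of T have total
   size m). *)
Fixpoint gw_tp (fuel m : nat) : R :=
  match fuel with
  | 0%N => 0
  | S f =>
    let fix forest (k m : nat) : R :=
      match k with
      | 0%N => if m == 0%N then 1 else 0
      | S k' => \sum_(j < m) gw_tp f j.+1 * forest k' (m - j.+1)%N
      end
    in \sum_(k < m) p k * forest k m.-1
  end.

Definition gw_size_prob (n : nat) : R := gw_tp n n.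

Definition Phi (t : R) : \bar R := (\sum_(0 <= k <oo) (p k * t ^+ k)%:E)%E.
Definition dPhi (t : R) : \bar R :=
  (\sum_(0 <= k <oo) (k%:R * p k * t ^+ k.-1)%:E)%E.
(* radius of convergence of Phi (nonnegative coefficients) *)
Definition xi_rho : \bar R :=
  ereal_sup [set t%:E | t in [set t : R | 0 <= t /\ (Phi t < +oo)%E]].
(* Psi(t) = t Phi'(t) / Phi(t), for t with Phi(t) finite *)
Definition Psi (t : R) : \bar R :=
  (t%:E * dPhi t * ((fine (Phi t))^-1)%:E)%E.
Definition xi_nu : \bar R :=
  match xi_rho with
  | r%:E => if (Phi r < +oo)%E then Psi r
            else lim (Psi t @[t --> r^'-])
  | _ => lim (Psi t @[t --> +oo])
  end.
Definition xi_mean : \bar R := dPhi 1.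
Definition is_span (d : nat) : Prop :=
  (forall k, 0 < p k -> (d %| k)%N) /\
  (forall d', (forall k, 0 < p k -> (d' %| k)%N) -> (d' <= d)%N).
Definition xi_span : nat := xget 0%N [set d | is_span d].

Definition tau_spec (tau : R) : Prop :=
  ((1 <= xi_nu)%E /\ 0 <= tau /\ (tau%:E <= xi_rho)%E /\ (Phi tau < +oo)%E
     /\ Psi tau = 1%E)
  \/ ((xi_nu < 1)%E /\ tau%:E = xi_rho).
End GW.

(* Main.v *)
Require Import Defs.
From HB Require Import structures.
From mathcomp Require Import all_boot all_order all_algebra.
From mathcomp Require Import all_classical all_reals all_analysis.
From mathcomp Require Import ring lra zify.
Import Order.TTheory GRing.Theory Num.Theory.
Import numFieldNormedType.Exports.
Local Open Scope classical_set_scope.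
Local Open Scope ring_scope.

(* Write q n = P(|T| = n). Grafting a tree at the first leaf of another one gives
   q m * q n <= P(xi = 0) * q (m + n - 1), so n |-> q (n + 1) / P(xi = 0) is
   supermultiplicative and (1/n) log (q n) has a limit, by Fekete's argument along
   the multiples of the span, namely minus the logarithm of the radius of
   convergence of y(z) = sum_n q n z^n. If z Phi(t) <= t then y(z) <= t, by
   induction on the truncations of y; conversely, if y(z) is finite then
   t = y(z) satisfies z Phi(t) <= t. Hence the radius of convergence is
   sup_t t / Phi(t).
   The minimum of Phi(t) / t is located with H(t) = sum_k (k - 1)^+ p_k t^k: since
   t Phi'(t) + p_0 = Phi(t) + H(t), one has Psi(t) >= 1 iff H(t) >= p_0, and tau
   is the largest t with H(t) <= p_0. The tangent line of Phi at tau then shows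
   that tau minimizes Phi(t) / t. *)

(** * Arithmetic of additive sets and of the span *)

(** Take for e the least positive difference of two elements of S. Remainders modulo e are again
    such differences, hence vanish, and a pair s, s + e in S generates every large multiple of e. *)
Lemma additive_nat_set_gcd (S : nat -> Prop) (u : nat) :
  S 0%N -> (forall m n, S m -> S n -> S (m + n)%N) -> (0 < u)%N -> S u ->
  exists2 e, (forall v, S v -> (e %| v)%N) &
    exists N, forall m, (N <= m)%N -> S (m * e)%N.
Proof.
move=> S0 SD u0 Su; have SM k v : S v -> S (k * v)%N.
  by move=> Sv; elim: k => [//|k IH]; rewrite mulSn; exact: SD.
pose P e := (0 < e)%N && `[< exists s, S s /\ S (s + e)%N >].
have exP : exists e, P e by exists u; rewrite /P u0; apply/asboolP; exists 0%N.
case: (ex_minnP exP) => e /andP[e0 /asboolP[s0 [Ss0 Sse0]]] e_min.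
have edvd v : S v -> (e %| v)%N.
  move=> Sv; rewrite /dvdn -leqn0 leqNgt; apply/negP => r0.
  have /e_min : P (v %% e)%N.
    (* With v = k e + r, the elements k (s0 + e) and v + k s0 of S differ by r. *)
    rewrite /P r0; apply/asboolP; exists (v %/ e * (s0 + e))%N; split; first exact: SM.
    have -> : (v %/ e * (s0 + e) + v %% e = v + v %/ e * s0)%N.
      by rewrite mulnDr -addnA -divn_eq addnC.
    by apply: SD => //; exact: SM.
  by rewrite leqNgt ltn_mod e0.
exists e => //.
have [s [s_gt0 Ss Sse]] : exists s, [/\ (0 < s)%N, S s & S (s + e)%N].
  by exists (s0 + u)%N; split; [lia|exact: SD|rewrite addnAC; exact: SD].
have /dvdnP[w sE] := edvd _ Ss.
have w0 : (0 < w)%N by case: w sE s_gt0 => // ->.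
(* With s = w e and m = a w + b, b < w, one has m e = (a - b) s + b (s + e); the bound m >= w^2
   ensures b <= a. *)
exists (w * w)%N => m wm.
have le_mod : (m %% w <= m %/ w)%N.
  by rewrite (leq_trans (ltnW (ltn_pmod m w0))) // leq_divRL.
have -> : (m * e = (m %/ w - m %% w) * s + m %% w * (s + e))%N.
  by rewrite {1}(divn_eq m w) sE mulnBl mulnDr addnA subnK ?leq_mul //; ring.
by apply: SD; exact: SM.
Qed.

(** Common divisors of the support are bounded by any positive element of it, so a largest one
    exists and [xget] does not fall back on its default. *)
Lemma xi_spanP {R : realType} (p : nat -> R) :
  (exists2 k, (0 < k)%N & 0 < p k) -> is_span p (xi_span p).
Proof.
move=> [k k0 pk]; apply: (@xgetPex _ 0%N [set d | is_span p d]).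
pose P d := `[< forall k, 0 < p k -> (d %| k)%N >].
have exP : exists d, P d by exists 1%N; apply/asboolP => j _; exact: dvd1n.
have ubP d : P d -> (d <= k)%N by move=> /asboolP /(_ _ pk) /dvdn_leq; exact.
case: (ex_maxnP exP ubP) => d /asboolP dvd_d d_max.
by exists d; split => // d' d'P; apply: d_max; exact/asboolP.
Qed.

Lemma pos_lower_bound {R : realType} (f : nat -> R) n :
  (forall i, (i < n)%N -> 0 < f i) ->
  exists2 C, 0 < C & forall i, (i < n)%N -> C <= f i.
Proof.
elim: n => [|n IH] f0; first by exists 1.
have [|C C0 Cf] := IH; first by move=> i ltin; rewrite f0 // ltnW.
exists (Num.min C (f n)); first by rewrite lt_min C0 f0.
move=> i; rewrite ltnS leq_eqVlt => /predU1P[->|ltin].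
  by rewrite ge_min lexx orbT.
by rewrite ge_min Cf.
Qed.

(** * Size distribution of Galton-Watson trees *)

(* Same shape as the local fixpoint of [gw_tp], so that [gw_tpS] holds by
   conversion. *)
Definition forest_sum {R : realType} (g : nat -> R) :=
  fix forest (k m : nat) : R :=
    match k with
    | 0%N => if m == 0%N then 1 else 0
    | S k' => \sum_(j < m) g j.+1 * forest k' (m - j.+1)%N
    end.

Lemma gw_tpS {R : realType} (p : nat -> R) f m :
  gw_tp p f.+1 m = \sum_(k < m) p k * forest_sum (gw_tp p f) k m.-1.
Proof. by []. Qed.

Lemma eq_forest_sum {R : realType} (g h : nat -> R) k m :
  (forall j, (j <= m)%N -> g j = h j) -> forest_sum g k m = forest_sum h k m.
Proof.
elim: k m => // k IH m gh /=; apply: eq_bigr => j _.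
rewrite gh // IH // => i /leq_trans le_i; apply: gh; apply: le_i.
exact: leq_subr.
Qed.

(** The subtrees below the root of a tree of size m have size at most m - 1, so one unit of fuel per
    level suffices. *)
Lemma gw_tp_fuel {R : realType} (p : nat -> R) f f' m :
  (m <= f)%N -> (m <= f')%N -> gw_tp p f m = gw_tp p f' m.
Proof.
elim: f f' m => [|f IH] [|f'] m.
- by [].
- by rewrite leqn0 => /eqP -> _; rewrite gw_tpS big_ord0.
- by move=> _; rewrite leqn0 => /eqP ->; rewrite gw_tpS big_ord0.
move=> mf mf'; rewrite !gw_tpS; apply: eq_bigr => k _; congr (_ * _).
apply: eq_forest_sum => j jm; move: (ltn_ord k) => km; apply: IH; lia.
Qed.

(** Partial sums are values of polynomials, so their Cauchy product is a product of polynomials. *)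
Lemma horner_truncM {R : realType} (a b : nat -> R) N M z :
  (\sum_(i < N) a i * z ^+ i) * (\sum_(i < M) b i * z ^+ i) =
  \sum_(i < N + M) (\poly_(i < N) a i * \poly_(i < M) b i)`_i * z ^+ i.
Proof.
rewrite -[X in X * _]horner_poly -[X in _ * X]horner_poly -hornerM.
rewrite (horner_coef_wide _ (n := N + M)) //.
rewrite (leq_trans (size_polyMleq _ _)) // (leq_trans (leq_pred _)) //.
by rewrite leq_add // size_poly.
Qed.

Section CauchyProduct.
Context {R : realType} (a b : nat -> R) (z : R).
Hypotheses (a_ge0 : forall n, 0 <= a n) (b_ge0 : forall n, 0 <= b n) (z_ge0 : 0 <= z).

Let c i := \sum_(j < i.+1) a j * b (i - j)%N.

Lemma Cauchy_prod_trunc_ge N M :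
  (\sum_(i < N) a i * z ^+ i) * (\sum_(i < M) b i * z ^+ i) <=
  \sum_(i < N + M) c i * z ^+ i.
Proof.
rewrite horner_truncM; apply: ler_sum => i _; rewrite ler_wpM2r ?exprn_ge0 //.
rewrite coefM; apply: ler_sum => j _; rewrite !coef_poly.
by do 2!case: ifP => _; rewrite ?mulr0 ?mul0r ?mulr_ge0.
Qed.

Lemma Cauchy_prod_trunc_le M :
  \sum_(i < M) c i * z ^+ i <=
  (\sum_(i < M) a i * z ^+ i) * (\sum_(i < M) b i * z ^+ i).
Proof.
rewrite horner_truncM big_split_ord /= ler_wpDr //.
  apply: sumr_ge0 => i _; rewrite mulr_ge0 ?exprn_ge0 // coefM sumr_ge0 // => j _.
  by rewrite !coef_poly; do 2!case: ifP => _; rewrite ?mulr0 ?mul0r ?mulr_ge0.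
apply: ler_sum => i _; rewrite ler_wpM2r ?exprn_ge0 // coefM.
apply: ler_sum => j _; have := ltn_ord i; have := ltn_ord j => ltj lti.
by rewrite !coef_poly !ifT //; lia.
Qed.

End CauchyProduct.

Section GaltonWatson.
Context {R : realType} (p : nat -> R).
Hypothesis p_ge0 : forall k, 0 <= p k.

Local Notation q := (gw_size_prob p).
Local Notation F := (forest_sum (gw_size_prob p)).

Lemma gw_size_prob0 : q 0 = 0. Proof. by []. Qed.

Lemma gw_size_probS m : q m.+1 = \sum_(k < m.+1) p k * F k m.
Proof.
rewrite /gw_size_prob gw_tpS; apply: eq_bigr => k _; congr (_ * _).
by apply: eq_forest_sum => j jm; apply: gw_tp_fuel.
Qed.

Lemma gw_size_prob1 : q 1 = p 0%N.
Proof. by rewrite gw_size_probS big_ord1 /= mulr1. Qed.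

Lemma gw_tp_ge0 f m : 0 <= gw_tp p f m.
Proof.
elim: f m => [|f IH] m //; rewrite gw_tpS; apply: sumr_ge0 => k _.
apply: mulr_ge0 => //; elim: (k : nat) m.-1 => [|k' IHk] m' /=; first by case: eqP.
by apply: sumr_ge0 => j _; apply: mulr_ge0.
Qed.

Lemma gw_size_prob_ge0 n : 0 <= q n. Proof. exact: gw_tp_ge0. Qed.

Lemma forest_sum_ge0 k m : 0 <= F k m.
Proof.
elim: k m => [|k IH] m /=; first by case: eqP.
by apply: sumr_ge0 => j _; apply: mulr_ge0 => //; exact: gw_size_prob_ge0.
Qed.

Lemma forest_sum_small k m : (m < k)%N -> F k m = 0.
Proof.
elim: k m => // k IH m mk /=; apply: big1 => j _.
by rewrite IH ?mulr0 //; have := ltn_ord j; lia.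
Qed.

Lemma forest_sumS k m : F k.+1 m = \sum_(j < m.+1) q j * F k (m - j)%N.
Proof. by rewrite big_ord_recl gw_size_prob0 mul0r add0r. Qed.

(** A range of k independent of m allows sums over k and m to be exchanged, and sums for different
    sizes to be compared termwise. *)
Lemma gw_size_probS_wide m N : (m < N)%N -> q m.+1 = \sum_(k < N) p k * F k m.
Proof.
move=> mN; rewrite gw_size_probS (big_ord_widen N (fun k => p k * F k m)) //.
rewrite [RHS](bigID (fun k : 'I_N => (k < m.+1)%N)) /= [X in _ + X]big1 ?addr0 //.
by move=> i im; rewrite forest_sum_small ?mulr0 //; lia.
Qed.

Lemma gw_size_probS_ge m K : \sum_(k < K) p k * F k m <= q m.+1.
Proof.
rewrite (@gw_size_probS_wide m (K + m.+1)%N) ?big_split_ord /=; last lia.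
by rewrite lerDl sumr_ge0 // => k _; rewrite mulr_ge0 ?forest_sum_ge0.
Qed.

Lemma gw_size_prob_ge m k : p k * F k m <= q m.+1.
Proof.
apply: le_trans (gw_size_probS_ge m k.+1); rewrite big_ord_recr /= lerDr.
by apply: sumr_ge0 => i _; rewrite mulr_ge0 ?forest_sum_ge0.
Qed.

(** This counts only the star: a root whose k children are all leaves. *)
Lemma gw_size_prob_star k : p k * p 0%N ^+ k <= q k.+1.
Proof.
apply: le_trans (gw_size_prob_ge k k); rewrite ler_wpM2l //.
elim: k => [|k IH] //; rewrite [leRHS]/=.
rewrite big_ord_recl /= subn1 /= gw_size_prob1 exprS.
rewrite (le_trans (ler_wpM2l (p_ge0 0) IH)) // lerDl.
by apply: sumr_ge0 => j _; rewrite mulr_ge0 ?forest_sum_ge0 ?gw_size_prob_ge0.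
Qed.

(* Graft a tree of size n at the first leaf of a tree of size m: among the
   descendants along the leftmost branch, sizes strictly decrease, so the
   grafting point can be recovered from n. *)
Lemma gw_size_prob_graft m n : q m * q n <= p 0%N * q (m + n).-1.
Proof.
case: n => [|n]; first by rewrite gw_size_prob0 mulr0 mulr_ge0 ?gw_size_prob_ge0.
rewrite addnS /=.
elim/ltn_ind: m => -[|m] IH.
  by rewrite gw_size_prob0 mul0r mulr_ge0 ?gw_size_prob_ge0.
case: m IH => [|m] IH; first by rewrite gw_size_prob1.
rewrite (_ : m.+2 + n = (m.+1 + n).+1)%N // (gw_size_probS (m.+1 + n)).
rewrite (@gw_size_probS_wide m.+1 (m.+1 + n).+1); last lia.
rewrite mulr_suml mulr_sumr; apply: ler_sum => -[[|k] /= ltk] _.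
  by rewrite mulr0 mul0r !mulr_ge0 //; case: eqP.
have nn j i : 0 <= p 0%N * (q j * F k i).
  by rewrite !mulr_ge0 ?forest_sum_ge0 ?gw_size_prob_ge0.
(* Grafting inside the first subtree turns its size j + 1 into n + j + 1. On the right the terms
   whose first subtree has size at most n are dropped; the induction hypothesis handles the
   others. *)
rewrite mulrCA -mulrA ler_wpM2l // mulr_suml mulr_sumr addnC big_split_ord /=.
rewrite ler_wpDl ?sumr_ge0 //; apply: ler_sum => j _; rewrite mulrAC mulrA.
rewrite (_ : n + m.+1 - (n + j).+1 = m.+1 - j.+1)%N; last lia.
rewrite ler_wpM2r ?forest_sum_ge0 // (_ : (n + j).+1 = j.+1 + n)%N; last lia.
by apply: IH; rewrite ltnS.
Qed.

Lemma gw_size_prob_graftS m n : q m.+1 * q n.+1 <= p 0%N * q (m + n).+1.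
Proof. by have := gw_size_prob_graft m.+1 n.+1; rewrite addSn addnS. Qed.

(** * Truncations of the generating function y(z) and of its powers *)

Section GeneratingFunction.
Variable z : R.
Hypothesis z_ge0 : 0 <= z.

Local Notation Y N := (\sum_(n < N) q n * z ^+ n).

Lemma gw_gen_ge0 N : 0 <= Y N.
Proof.
by apply: sumr_ge0 => n _; rewrite mulr_ge0 ?exprn_ge0 ?gw_size_prob_ge0.
Qed.

(** A forest of size below M only contains trees of size below M. *)
Lemma forest_gen_le k M : \sum_(m < M) F k m * z ^+ m <= Y M ^+ k.
Proof.
elim: k => [|k IH].
  case: M => [|M]; first by rewrite big_ord0 ler01.
  rewrite big_ord_recl /= mulr1 expr0 big1 ?addr0 // => i _.
  by rewrite mul0r.
under eq_bigr do rewrite forest_sumS.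
have := @Cauchy_prod_trunc_le R q (F k) z gw_size_prob_ge0 (forest_sum_ge0 k) z_ge0 M.
by move=> /le_trans; apply; rewrite exprS ler_wpM2l ?gw_gen_ge0.
Qed.

Lemma forest_gen_ge k N : Y N ^+ k <= \sum_(m < (k * N).+1) F k m * z ^+ m.
Proof.
elim: k => [|k IH]; first by rewrite big_ord1 /= mulr1.
under [leRHS]eq_bigr do rewrite forest_sumS.
rewrite exprS mulSn -addnS.
apply: le_trans (@Cauchy_prod_trunc_ge R q (F k) z gw_size_prob_ge0
                   (forest_sum_ge0 k) z_ge0 N (k * N).+1).
by rewrite ler_wpM2l ?gw_gen_ge0.
Qed.

Lemma gw_genS M : Y M.+1 = z * \sum_(m < M) q m.+1 * z ^+ m.
Proof.
rewrite big_ord_recl gw_size_prob0 mul0r add0r mulr_sumr.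
by apply: eq_bigr => m _; rewrite exprS mulrCA.
Qed.

(** The truncation of y at M + 1 is at most z Phi of the truncation at M, so the bound t
    propagates. *)
Lemma gw_gen_upper t N : 0 <= t ->
  (forall K, z * \sum_(k < K) p k * t ^+ k <= t) -> Y N <= t.
Proof.
move=> t0 zt; elim: N => [|M IH]; first by rewrite big_ord0.
rewrite gw_genS; apply: le_trans (zt M); rewrite ler_wpM2l //.
under eq_bigr => m _ do rewrite (@gw_size_probS_wide m M) // mulr_suml.
rewrite exchange_big /=; apply: ler_sum => k _.
under eq_bigr do rewrite -mulrA.
rewrite -mulr_sumr ler_wpM2l // (le_trans (forest_gen_le k M)) //.
by rewrite lerXn2r ?nnegrE ?gw_gen_ge0.
Qed.

(** A root of degree k < K carrying trees of size below N yields a tree of size below K N + 2. *)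
Lemma gw_gen_lower K N :
  z * \sum_(k < K) p k * Y N ^+ k <= Y (K * N).+2.
Proof.
rewrite gw_genS ler_wpM2l //.
have le_m (k : 'I_K) : Y N ^+ k <= \sum_(m < (K * N).+1) F k m * z ^+ m.
  apply: le_trans (forest_gen_ge k N) _.
  rewrite (big_ord_widen (K * N).+1 (fun m => F k m * z ^+ m)); last first.
    by have := ltn_ord k; rewrite ltnS leq_mul2r => /ltnW ->; rewrite orbT.
  rewrite big_mkcond; apply: ler_sum => m _; case: ifP => // _.
  by rewrite mulr_ge0 ?exprn_ge0 ?forest_sum_ge0.
apply: (@le_trans _ _ (\sum_(k < K) p k * \sum_(m < (K * N).+1) F k m * z ^+ m)).
  by apply: ler_sum => k _; rewrite ler_wpM2l.
under eq_bigr do rewrite mulr_sumr.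
rewrite exchange_big /=; apply: ler_sum => m _.
under eq_bigr do rewrite mulrA.
by rewrite -mulr_suml ler_wpM2r ?exprn_ge0 ?gw_size_probS_ge.
Qed.

(* The sum [t] of the generating function in fact satisfies [t = z * Phi t]. *)
Lemma gw_gen_fixpoint_ge B : (forall N, Y N <= B) ->
  exists2 t, (forall N, Y N <= t) & forall K, z * \sum_(k < K) p k * t ^+ k <= t.
Proof.
move=> YB; have Ynd : {homo (fun N => Y N) : n m / (n <= m)%N >-> n <= m}.
  move=> n m nm; rewrite (big_ord_widen m (fun i => q i * z ^+ i)) // big_mkcond.
  apply: ler_sum => i _; case: ifP => // _.
  by rewrite mulr_ge0 ?exprn_ge0 ?gw_size_prob_ge0.
have Ycvg : cvgn (fun N => Y N).
  by apply: nondecreasing_is_cvgn => //; exists B => _ [N _ <-].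
have Yt := nondecreasing_cvgn_le Ynd Ycvg.
exists (limn (fun N => Y N)) => // K.
rewrite -horner_poly; set P := \poly_(k < K) p k.
have PY : (z * P.[Y N]) @[N --> \oo] --> z * P.[limn (fun N => Y N)].
  apply: cvgM; first exact: cvg_cst.
  exact: (cvg_comp (fun N => Y N) (horner P) Ycvg (@continuous_horner R P _)).
rewrite -(cvg_lim _ PY) //; apply: limr_le; first exact: (cvgP _ PY).
by apply: nearW => N; rewrite horner_poly (le_trans (gw_gen_lower K N)).
Qed.

End GeneratingFunction.

(** * Exponential growth rate of the size probabilities *)

Section Growth.
Hypothesis p0_gt0 : 0 < p 0%N.

Lemma gw_size_prob_graft_gt0 m n :
  0 < q m.+1 -> 0 < q n.+1 -> 0 < q (m + n).+1.
Proof.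
move=> qm qn; rewrite -(pmulr_rgt0 _ p0_gt0).
by apply: lt_le_trans (gw_size_prob_graftS m n); exact: mulr_gt0.
Qed.

Lemma gw_size_prob_gt0 : (exists2 k, (0 < k)%N & 0 < p k) ->
  exists K, forall k, (K <= k)%N -> 0 < q (k * xi_span p + 1).
Proof.
move=> exk; have [span_dvd span_max] := xi_spanP _ exk; have [k0 k0_gt0 pk0] := exk.
have q_supp k : 0 < p k -> 0 < q k.+1.
  by move=> pk; apply: lt_le_trans (gw_size_prob_star k); rewrite mulr_gt0 ?exprn_gt0.
have [||e edvd [N SN]] := @additive_nat_set_gcd (fun n => 0 < q n.+1) k0 _ _ k0_gt0
  (q_supp _ pk0); [by rewrite gw_size_prob1|exact: gw_size_prob_graft_gt0|].
have edvdp k : 0 < p k -> (e %| k)%N by move=> /q_supp /edvd.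
have span_gt0 : (0 < xi_span p)%N.
  by apply: span_max => k _; exact: dvd1n.
have e_gt0 : (0 < e)%N by exact: dvdn_gt0 k0_gt0 (edvdp _ pk0).
have e_span : (e %| xi_span p)%N.
  (* The support of p lies in the additive set, so e divides it; the lcm of e and the span is then a
     common divisor, and maximality of the span makes e divide the span. *)
  have /span_max le_span : forall k, 0 < p k -> (lcmn e (xi_span p) %| k)%N.
    by move=> k pk; rewrite dvdn_lcm edvdp // span_dvd.
  have <- : lcmn e (xi_span p) = xi_span p; last exact: dvdn_lcml.
  by apply/eqP; rewrite eqn_leq le_span dvdn_leq ?dvdn_lcmr // lcmn_gt0 e_gt0.
exists N => k Nk; rewrite addn1 -(divnK e_span) mulnA; apply: SN.
apply: leq_trans Nk _; apply: leq_pmulr.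
by rewrite divn_gt0 // dvdn_leq.
Qed.

(** Grafting d copies of the good size n + 1 moves k to k + n for a factor a^(d n), so C only has to
    serve the n values of k from K on. *)
Lemma gw_size_prob_lower d K n a : 0 <= a -> (0 < n)%N ->
  (forall k, (K <= k)%N -> 0 < q (k * d).+1) ->
  p 0%N * a ^+ n <= q n.+1 ->
  exists2 C, 0 < C & forall k, (K <= k)%N -> C * a ^+ (k * d) <= q (k * d).+1.
Proof.
move=> a0 n0 qK qn.
have qjn j : p 0%N * a ^+ (j * n) <= q (j * n).+1.
  elim: j => [|j IH]; first by rewrite mulr1 gw_size_prob1.
  rewrite -(ler_pM2l p0_gt0) mulSn.
  apply: le_trans (gw_size_prob_graftS n (j * n)).
  by rewrite exprD [leLHS]mulrA mulrACA ler_pM // mulr_ge0 ?exprn_ge0.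
have [C C0 CK] : exists2 C, 0 < C &
    forall k, (K <= k < K + n)%N -> C * a ^+ (k * d) <= q (k * d).+1.
  have [i _|C C0 Cf] := @pos_lower_bound R
    (fun i => q ((K + i) * d).+1 / (a ^+ ((K + i) * d) + 1)) n.
    by rewrite divr_gt0 ?qK ?leq_addr // ltr_wpDl ?exprn_ge0.
  exists C => // k /andP[Kk kn].
  have := Cf (k - K)%N; rewrite subnKC // ler_pdivlMr ?ltr_wpDl ?exprn_ge0 //.
  move=> Ck; apply: le_trans (Ck _); last by lia.
  by rewrite ler_wpM2l ?(ltW C0) // lerDl.
exists C => //; elim/ltn_ind => k IH Kk.
have [kn|kn] := ltnP k (K + n); first by rewrite CK ?Kk.
have kE : (k * d = d * n + (k - n) * d)%N by rewrite (mulnC d) -mulnDl subnKC //; lia.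
rewrite -(ler_pM2l p0_gt0) kE.
apply: le_trans (gw_size_prob_graftS (d * n) ((k - n) * d)).
rewrite exprD [leLHS]mulrA mulrACA.
by rewrite ler_pM ?qjn ?mulr_ge0 ?exprn_ge0 ?(ltW C0) // IH; lia.
Qed.

(** [lam] stands for the minimum of Phi(t) / t over t > 0 and [t0] for a minimizer, both described
    through partial sums. *)
Variables (lam t0 : R).
Hypotheses (lam_gt0 : 0 < lam) (t0_gt0 : 0 < t0).
Hypothesis Phi_t0 : forall K, \sum_(k < K) p k * t0 ^+ k <= lam * t0.
Hypothesis Phi_ge : forall t c, 0 < t ->
  (forall K, \sum_(k < K) p k * t ^+ k <= c * t) -> lam <= c.

(** At z = 1 / lam one has z Phi(t0) <= t0, so t0 bounds y(z) and each of its terms. *)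
Lemma gw_size_prob_upper n : q n <= t0 * lam ^+ n.
Proof.
rewrite -ler_pdivrMr ?exprn_gt0 // -exprVn.
apply: le_trans (@gw_gen_upper lam^-1 _ t0 n.+1 (ltW t0_gt0) _).
- rewrite big_ord_recr /= lerDr sumr_ge0 // => i _.
  by rewrite mulr_ge0 ?gw_size_prob_ge0 // exprn_ge0 ?invr_ge0 ?(ltW lam_gt0).
- by rewrite invr_ge0 ltW.
- by move=> K; rewrite mulrC ler_pdivrMr // [leRHS]mulrC.
Qed.

(** Otherwise y(1 / c) would be finite for some c strictly between a and lam, giving a t with Phi(t)
    <= c t against the minimality of lam. *)
Lemma gw_size_prob_large a : 0 < a < lam ->
  exists2 n, (0 < n)%N & p 0%N * a ^+ n <= q n.+1.
Proof.
move=> /andP[a0 alam]; apply: contrapT => nex.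
have qlt n : q n.+1 <= p 0%N * a ^+ n.
  case: n => [|n]; first by rewrite mulr1 gw_size_prob1.
  by rewrite leNgt; apply/negP => /ltW ltq; apply: nex; exists n.+1.
pose c := (a + lam) / 2; have ac : a < c by rewrite midf_lt.
have clam : c < lam by rewrite midf_lt.
have c0 : 0 < c by exact: lt_trans ac.
have x1 : 0 < 1 - a / c by rewrite subr_gt0 ltr_pdivrMr // mul1r.
have Yle N : \sum_(n < N) q n * c^-1 ^+ n <= p 0%N * c^-1 / (1 - a / c).
  case: N => [|N].
    by rewrite big_ord0 !mulr_ge0 ?invr_ge0 ?(ltW c0) ?(ltW x1).
  rewrite gw_genS.
  apply: (@le_trans _ _ (c^-1 * \sum_(n < N) p 0%N * (a / c) ^+ n)).
    rewrite ler_wpM2l ?invr_ge0 ?(ltW c0) //; apply: ler_sum => n _.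
    by rewrite exprMn mulrA ler_wpM2r // exprn_ge0 ?invr_ge0 ?(ltW c0).
  rewrite -mulr_sumr mulrA (mulrC c^-1) ler_wpM2l ?mulr_ge0 ?invr_ge0 ?(ltW c0) //.
  rewrite -[leRHS]mul1r ler_pdivlMr // mulrC -[X in X <= _]opprK -mulNr opprB -subrX1.
  by rewrite opprB gerBl exprn_ge0 // divr_ge0 ?ltW.
have [|t Yt Pt] := gw_gen_fixpoint_ge _ _ _ Yle; first by rewrite invr_ge0 ltW.
have t_gt0 : 0 < t.
  apply: lt_le_trans (Yt 2); rewrite 2!big_ord_recr big_ord0 /= gw_size_prob0.
  by rewrite mul0r !add0r gw_size_prob1 mulr_gt0 // invr_gt0.
move: clam; rewrite ltNge => /negP; apply; apply: (Phi_ge _ _ t_gt0) => K.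
by have := Pt K; rewrite mulrC ler_pdivrMr // [leRHS]mulrC.
Qed.

Lemma gw_size_prob_growth d K : (0 < d)%N ->
  (forall k, (K <= k)%N -> 0 < q (k * d + 1)) ->
  (fun k : nat => ln (q (k * d + 1)) / (k * d + 1)%:R) @ \oo --> ln lam.
Proof.
move=> d0 qK; apply/cvgrPdist_le => e e0.
(* Half of e is spent on replacing lam by a; the other half absorbs the constants collected in [M],
   including one ln lam because the exponent is k d instead of N. *)
pose a := lam * expR (- (e / 2)).
have a0 : 0 < a by rewrite mulr_gt0 ?expR_gt0.
have a_lam : 0 < a < lam.
  by rewrite a0 gtr_pMr // -expR0 ltr_expR oppr_lt0 divr_gt0.
have [n n0 qn] := gw_size_prob_large _ a_lam.
have [|C C0 Cq] := @gw_size_prob_lower d K n a (ltW a0) n0 _ qn.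
  by move=> k; rewrite -addn1; exact: qK.
have lna : ln a = ln lam - e / 2 by rewrite lnM ?posrE ?expR_gt0 // expRK.
pose M := `|ln C| + `|ln t0| + `|ln lam|.
near=> k.
have Kk : (K <= k)%N by near: k; exact: nbhs_infty_ge.
have Mk : 2 * M / e <= k%:R by near: k; exact: nbhs_infty_ger.
set N := (k * d + 1)%N; have N0 : 0 < N%:R :> R by rewrite ltr0n /N addn1.
have MN : 2 * M <= N%:R * e.
  rewrite -ler_pdivrMr // (le_trans Mk) // ler_nat /N.
  by rewrite (leq_trans _ (leq_addr _ _)) // leq_pmulr.
have NE : N%:R = (k * d)%:R + 1 :> R by rewrite /N natrD.
have q0 : 0 < q N by exact: qK.
have up : ln (q N) <= ln t0 + N%:R * ln lam.
  rewrite mulr_natl -lnXn // -lnM ?posrE ?exprn_gt0 //.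
  by rewrite ler_ln ?posrE ?mulr_gt0 ?exprn_gt0 // gw_size_prob_upper.
have lo : ln C + (k * d)%:R * (ln lam - e / 2) <= ln (q N).
  rewrite -lna mulr_natl -lnXn // -lnM ?posrE ?exprn_gt0 //.
  by rewrite ler_ln ?posrE ?mulr_gt0 ?exprn_gt0 // /N addn1 Cq.
have eNl x : `|x| <= N%:R * e -> `|x / N%:R| <= e.
  by rewrite normrM normfV (gtr0_norm N0) ler_pdivrMr // mulrC.
have -> : ln lam - ln (q N) / N%:R = (N%:R * ln lam - ln (q N)) / N%:R.
  by rewrite mulrBl mulrAC divff ?mul1r // lt0r_neq0.
apply: eNl; rewrite ler_norml.
have := ler_norm (ln C); have := ler_norm (- ln C).
have := ler_norm (ln t0); have := ler_norm (- ln t0).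
have := ler_norm (ln lam); have := ler_norm (- ln lam).
have := normr_ge0 (ln C); have := normr_ge0 (ln t0); have := normr_ge0 (ln lam).
rewrite !normrN; move: MN lo up; rewrite /M NE; nra.
Unshelve. all: by end_near. Qed.

End Growth.

End GaltonWatson.

(** * Power series with nonnegative coefficients *)

(** This is the tangent inequality for t^k at s, multiplied by s to avoid the exponent k - 1. Each
    induction step leaves a slack k s^k (t - s)^2. *)
Lemma tangent_exprn {R : realDomainType} (s t : R) k : 0 <= s -> 0 <= t ->
  k%:R * s ^+ k * (t - s) <= s * (t ^+ k - s ^+ k).
Proof.
move=> s0 t0; elim: k => [|k IH]; first by rewrite !expr0 subrr mulr0 !mul0r.
have -> : s * (t ^+ k.+1 - s ^+ k.+1) =
    t * (s * (t ^+ k - s ^+ k)) + s ^+ k.+1 * (t - s) by rewrite !exprS; ring.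
have -> : k.+1%:R * s ^+ k.+1 * (t - s) =
    t * (k%:R * s ^+ k * (t - s)) - k%:R * s ^+ k * (t - s) ^+ 2
    + s ^+ k.+1 * (t - s) by rewrite -natr1 !exprS; ring.
rewrite lerD2r lerBlDr (le_trans (ler_wpM2l t0 IH)) // lerDl.
by apply: mulr_ge0; [rewrite mulr_ge0 ?exprn_ge0|exact: sqr_ge0].
Qed.

Lemma tangent_exprn_lt {R : realDomainType} (s t : R) k : 0 < s -> 0 <= t ->
  (1 < k)%N -> t != s -> k%:R * s ^+ k * (t - s) < s * (t ^+ k - s ^+ k).
Proof.
case: k => // k s0 t0; rewrite ltnS => k0 ts.
have -> : s * (t ^+ k.+1 - s ^+ k.+1) =
    t * (s * (t ^+ k - s ^+ k)) + s ^+ k.+1 * (t - s) by rewrite !exprS; ring.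
have -> : k.+1%:R * s ^+ k.+1 * (t - s) =
    t * (k%:R * s ^+ k * (t - s)) - k%:R * s ^+ k * (t - s) ^+ 2
    + s ^+ k.+1 * (t - s) by rewrite -natr1 !exprS; ring.
rewrite ltrD2r ltrBlDr.
rewrite (le_lt_trans (ler_wpM2l t0 (tangent_exprn _ _ _ (ltW s0) t0))) // ltrDl.
apply: mulr_gt0; first by rewrite mulr_gt0 ?exprn_gt0 ?ltr0n.
by rewrite exprn_even_gt0 //= subr_eq0.
Qed.

(** Add the tangent inequalities at t, taken at s and u with weights u - t and t - s: the linear
    parts cancel. *)
Lemma convex_exprn {R : realFieldType} (s t u : R) k :
  0 <= s -> s <= t -> t <= u ->
  (u - s) * t ^+ k <= (u - t) * s ^+ k + (t - s) * u ^+ k.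
Proof.
move=> s0 st tu; have t0 := le_trans s0 st.
have [tz|tn0] := eqVneq t 0.
  have -> : s = 0 by apply: le_anti; rewrite s0 -tz st.
  by rewrite tz subr0 subrr mul0r addr0.
have {}t0 : 0 < t by rewrite lt_def tn0.
have ts := tangent_exprn t s k (ltW t0) s0.
have tu' := tangent_exprn t u k (ltW t0) (le_trans (ltW t0) tu).
have ut0 : 0 <= u - t by rewrite subr_ge0.
have ts0 : 0 <= t - s by rewrite subr_ge0.
rewrite -subr_ge0 -(pmulr_rge0 _ t0).
have := lerD (ler_wpM2l ut0 ts) (ler_wpM2l ts0 tu'); rewrite -subr_ge0.
by congr (0 <= _); ring.
Qed.

(** Constants become series, so that they can enter termwise comparisons. *)
Lemma nneseries_single {R : realType} (k0 : nat) (x : R) : 0 <= x ->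
  (\sum_(0 <= k <oo) ((k == k0)%:R * x)%:E = x%:E)%E.
Proof.
move=> x0; rewrite (nneseriesD1 (n := k0)) //; last first.
  by move=> k _; rewrite lee_fin mulr_ge0.
by rewrite eqxx mul1r eseries0 ?adde0 // => k _ /negPf /= ->; rewrite mul0r.
Qed.

Lemma lt_nneseries {R : realType} (u v : nat -> R) (k0 : nat) :
  (forall k, 0 <= u k) -> (forall k, u k <= v k) -> u k0 < v k0 ->
  (\sum_(0 <= k <oo) (u k)%:E < +oo)%E ->
  (\sum_(0 <= k <oo) (u k)%:E < \sum_(0 <= k <oo) (v k)%:E)%E.
Proof.
move=> u0 uv uv0 ufin; have d0 : 0 < v k0 - u k0 by rewrite subr_gt0.
have usum0 : (0 <= \sum_(0 <= k <oo) (u k)%:E)%E.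
  by apply: nneseries_ge0 => k _ _; rewrite lee_fin.
apply: (@lt_le_trans _ _ (\sum_(0 <= k <oo) (u k)%:E + (v k0 - u k0)%:E)%E).
  by rewrite lteDl ?lte_fin // ge0_fin_numE.
rewrite -(nneseries_single k0 _ (ltW d0)) -nneseriesD; first last.
- by move=> k _ _; rewrite lee_fin mulr_ge0 // ltW.
- by move=> k _ _; rewrite lee_fin.
apply: lee_nneseries => k _; first by rewrite adde_ge0 ?lee_fin ?mulr_ge0 // ltW.
rewrite -EFinD lee_fin; case: eqP => [->|_]; last by rewrite mul0r addr0.
by rewrite mul1r addrC subrK.
Qed.

Lemma nondecreasing_at_left_is_cvge {R : realType} (f : R -> \bar R) (a b : R) :
  b < a -> {in `]b, a[ &, {homo f : x y / x <= y >-> (x <= y)%E}} ->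
  cvg (f x @[x --> a^'-]).
Proof.
move=> ba fnd; suff : cvg ((f \o -%R) x @[x --> (- a)^'+]).
  by move=> /cvg_ex[/= l fl]; apply/cvg_ex; exists l; exact/cvg_at_leftNP.
apply: nonincreasing_at_right_is_cvge; near=> x => y z.
have xb : x <= - b by near: x; apply: nbhs_right_le; rewrite ltrN2.
rewrite !in_itv /= => /andP[ay yx] /andP[az zx] yz.
apply: fnd; rewrite ?in_itv /= ?lerN2 //; apply/andP; split; lra.
Unshelve. all: by end_near. Qed.

(** * Order, convexity and tangent inequalities for power series *)

Definition pser {R : realType} (a : nat -> R) (t : R) : \bar R :=
  (\sum_(0 <= k <oo) (a k * t ^+ k)%:E)%E.

Section PowerSeries.
Context {R : realType}.
Implicit Types (a b : nat -> R) (s t u : R).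

Lemma pser_ge0 a t : (forall k, 0 <= a k) -> 0 <= t -> (0 <= pser a t)%E.
Proof.
by move=> a0 t0; apply: nneseries_ge0 => k _ _; rewrite lee_fin mulr_ge0 ?exprn_ge0.
Qed.

Lemma pser_trunc_le a t K : (forall k, 0 <= a k) -> 0 <= t ->
  ((\sum_(k < K) a k * t ^+ k)%:E <= pser a t)%E.
Proof.
move=> a0 t0; rewrite -sumEFin -(big_mkord xpredT (fun k => (a k * t ^+ k)%:E)).
by apply: nneseries_lim_ge => k _ _; rewrite lee_fin mulr_ge0 ?exprn_ge0.
Qed.

Lemma pser_term_le a t k : (forall k, 0 <= a k) -> 0 <= t ->
  ((a k * t ^+ k)%:E <= pser a t)%E.
Proof.
move=> a0 t0; apply: le_trans (pser_trunc_le a t k.+1 a0 t0).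
rewrite lee_fin big_ord_recr /= lerDr sumr_ge0 // => i _.
by rewrite mulr_ge0 ?exprn_ge0.
Qed.

Lemma pser_le a t c : (forall k, 0 <= a k) -> 0 <= t ->
  (forall K, \sum_(k < K) a k * t ^+ k <= c) -> (pser a t <= c%:E)%E.
Proof.
move=> a0 t0 ac; apply: lime_le.
  by apply: is_cvg_nneseries => k _ _; rewrite lee_fin mulr_ge0 ?exprn_ge0.
by apply: nearW => K; rewrite big_mkord sumEFin lee_fin.
Qed.

Lemma le_pser a s t : (forall k, 0 <= a k) -> 0 <= s -> s <= t ->
  (pser a s <= pser a t)%E.
Proof.
move=> a0 s0 st; apply: lee_nneseries => k _; rewrite lee_fin.
  by rewrite mulr_ge0 ?exprn_ge0.
by rewrite ler_wpM2l // lerXn2r ?nnegrE ?(le_trans s0).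
Qed.

Lemma lt_pser a s t k : (forall k, 0 <= a k) -> 0 <= s -> s < t ->
  (0 < k)%N -> 0 < a k -> (pser a s < +oo)%E -> (pser a s < pser a t)%E.
Proof.
move=> a0 s0 st k0 ak; apply: (lt_nneseries _ _ k).
- by move=> j; rewrite mulr_ge0 ?exprn_ge0.
- by move=> j; rewrite ler_wpM2l // lerXn2r ?nnegrE ?(le_trans s0) // ltW.
- by rewrite ltr_pM2l // ltrXn2r // -lt0n.
Qed.

(** Each partial sum is a polynomial, hence left-continuous. This makes the supremum that defines
    tau satisfy its own constraint. *)
Lemma pser_left_closed a c t : (forall k, 0 <= a k) -> 0 < t ->
  (forall s, 0 <= s < t -> (pser a s <= c%:E)%E) -> (pser a t <= c%:E)%E.
Proof.
move=> a0 t0 ac; apply: pser_le => // [|K]; first exact: ltW.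
rewrite -horner_poly; set P := \poly_(k < K) a k.
have Pt : P.[s] @[s --> t^'-] --> P.[t].
  by apply: cvg_at_left_filter; exact: continuous_horner.
rewrite -(cvg_lim _ Pt) //; apply: limr_le; first exact: (cvgP _ Pt).
near=> s; have s0 : 0 <= s by near: s; exact: nbhs_left_ge.
rewrite -lee_fin horner_poly; apply: le_trans (pser_trunc_le a s K a0 s0) _.
by apply: ac; rewrite s0; near: s; exact: nbhs_left_lt.
Unshelve. all: by end_near. Qed.

Lemma pser_scale c a t : (forall k, 0 <= a k) -> 0 <= t ->
  (c%:E * pser a t = \sum_(0 <= k <oo) (c * (a k * t ^+ k))%:E)%E.
Proof.
move=> a0 t0; rewrite -nneseriesZl // => k _.
by rewrite lee_fin mulr_ge0 ?exprn_ge0.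
Qed.

Lemma pser_comb c d a b s t : 0 <= c -> 0 <= d ->
  (forall k, 0 <= a k) -> (forall k, 0 <= b k) -> 0 <= s -> 0 <= t ->
  (c%:E * pser a s + d%:E * pser b t =
   \sum_(0 <= k <oo) (c * (a k * s ^+ k) + d * (b k * t ^+ k))%:E)%E.
Proof.
move=> c0 d0 a0 b0 s0 t0; rewrite !pser_scale // -nneseriesD //.
- by move=> k _ _; rewrite lee_fin mulr_ge0 // mulr_ge0 ?exprn_ge0.
- by move=> k _ _; rewrite lee_fin mulr_ge0 // mulr_ge0 ?exprn_ge0.
Qed.

Lemma le_nneseries_fin (u v : nat -> R) : (forall k, 0 <= u k) ->
  (forall k, u k <= v k) ->
  (\sum_(0 <= k <oo) (u k)%:E <= \sum_(0 <= k <oo) (v k)%:E)%E.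
Proof. by move=> u0 uv; apply: lee_nneseries => k *; rewrite lee_fin. Qed.

Lemma pser_convex a s u t : (forall k, 0 <= a k) -> 0 <= s -> s <= t -> t <= u ->
  ((u - s)%:E * pser a t <= (u - t)%:E * pser a s + (t - s)%:E * pser a u)%E.
Proof.
move=> a0 s0 st tu; have t0 := le_trans s0 st; have u0 := le_trans t0 tu.
rewrite pser_comb ?subr_ge0 // pser_scale //; apply: le_nneseries_fin => k.
  by rewrite mulr_ge0 ?subr_ge0 ?(le_trans st) // mulr_ge0 ?exprn_ge0.
have := ler_wpM2l (a0 k) (convex_exprn s t u k s0 st tu).
by move: (s ^+ k) (t ^+ k) (u ^+ k) => x y z; lra.
Qed.

Section Derivative.
Variable a : nat -> R.
Hypothesis a_ge0 : forall k, 0 <= a k.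
(** The series with these coefficients is t times the derivative; keeping the exponent k avoids
    index shifts. *)
Let a' := fun k => k%:R * a k.

Let a'_ge0 k : 0 <= a' k. Proof. by rewrite mulr_ge0. Qed.

(** Negative terms of the tangent inequality are moved across, so that no infinite sums are
    subtracted. *)
Lemma pser_tangent s t : 0 <= s -> 0 <= t ->
  (s%:E * pser a s + t%:E * pser a' s <= s%:E * pser a t + s%:E * pser a' s)%E.
Proof.
move=> s0 t0; rewrite !pser_comb //; apply: le_nneseries_fin => k.
  by rewrite addr_ge0 // mulr_ge0 // mulr_ge0 // exprn_ge0.
have := ler_wpM2l (a_ge0 k) (tangent_exprn s t k s0 t0).
by rewrite /a'; move: (s ^+ k) (t ^+ k) (k%:R : R) => x y z; lra.
Qed.

Lemma pser_tangent_lt s t k0 : 0 < s -> 0 <= t ->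
  t != s -> (1 < k0)%N -> 0 < a k0 ->
  (pser a s < +oo)%E -> (pser a' s < +oo)%E ->
  (s%:E * pser a s + t%:E * pser a' s < s%:E * pser a t + s%:E * pser a' s)%E.
Proof.
move=> s0 t0 st k1 ak0 afin a'fin; have s0' := ltW s0.
have sum_fin : (s%:E * pser a s + t%:E * pser a' s < +oo)%E.
  by rewrite lte_add_pinfty // lte_mul_pinfty ?lee_fin.
move: sum_fin; rewrite !pser_comb // => sum_fin; apply: (lt_nneseries _ _ k0) => //.
- by move=> k; rewrite addr_ge0 // mulr_ge0 // mulr_ge0 // exprn_ge0.
- move=> k; have := ler_wpM2l (a_ge0 k) (tangent_exprn s t k s0' t0).
  by rewrite /a'; move: (s ^+ k) (t ^+ k) (k%:R : R) => x y z; lra.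
- have := tangent_exprn_lt s t k0 s0 t0 k1 st; rewrite -(ltr_pM2l ak0).
  by rewrite /a'; move: (s ^+ k0) (t ^+ k0) (k0%:R : R) => x y z; lra.
Qed.

(* Termwise this is [k s^k (u - s) <= s u^k], the tangent inequality. *)
Lemma pser_deriv_bound s u : 0 <= s -> s <= u ->
  ((u - s)%:E * pser a' s <= s%:E * pser a u)%E.
Proof.
move=> s0 su; have u0 := le_trans s0 su.
rewrite !pser_scale //; apply: le_nneseries_fin => k.
  by rewrite mulr_ge0 ?subr_ge0 // mulr_ge0 ?exprn_ge0.
have := ler_wpM2l (a_ge0 k) (tangent_exprn s u k s0 u0).
have : 0 <= a k * (s * s ^+ k) by rewrite !mulr_ge0 ?exprn_ge0.
by rewrite /a'; move: (s ^+ k) (u ^+ k) (k%:R : R) => x y z; lra.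
Qed.

(* With [m] the integer part of [c], [(k - c) (t^k s^m - t^m s^k) >= 0]
   for every [k]. *)
Lemma pser_logderiv_mono s t c : 0 < s -> s <= t -> 0 <= c ->
  (pser a s < +oo)%E -> pser a' s = (c%:E * pser a s)%E ->
  (c%:E * pser a t <= pser a' t)%E.
Proof.
move=> s0 st c0 afin Kc.
have t0 : 0 < t := lt_le_trans s0 st.
have /andP[mc cm] := truncn_itv c0; set m := Num.truncn c in mc cm.
have sm : 0 < s ^+ m by rewrite exprn_gt0.
have tm : 0 < t ^+ m by rewrite exprn_gt0.
have afin' : pser a s \is a fin_num by rewrite ge0_fin_numE // pser_ge0 // ltW.
have fin : ((t ^+ m)%:E * pser a' s)%E \is a fin_num by rewrite Kc !fin_numM.
(* Multiply by s^m and add the finite t^m [pser a' s], rewritten on the right as t^m c [pser a s]: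
   the claim becomes termwise. *)
rewrite -(lee_pmul2l (x := (s ^+ m)%:E)) // -(leeD2rE _ _ fin).
rewrite {2}Kc !muleA -!EFinM.
rewrite !pser_comb ?mulr_ge0 ?(ltW sm) ?(ltW tm) ?(ltW s0) ?(ltW t0) //.
apply: le_nneseries_fin => k.
  by rewrite addr_ge0 // mulr_ge0 ?mulr_ge0 ?exprn_ge0 // ltW.
have : 0 <= a k * ((k%:R - c) * (t ^+ k * s ^+ m - t ^+ m * s ^+ k)).
  (* If k > m then k >= m + 1 > c, and if k <= m then k <= c; both factors have the same sign. *)
  apply: mulr_ge0 => //; have [mk|km] := ltnP m k.
    apply: mulr_ge0; first by rewrite subr_ge0 (le_trans (ltW cm)) // ler_nat.
    rewrite -(subnK (ltnW mk)) !exprD.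
    rewrite [X in 0 <= X](_ : _ = t ^+ m * s ^+ m * (t ^+ (k - m) - s ^+ (k - m))); last first.
      by move: (t ^+ m) (s ^+ m) (t ^+ _) (s ^+ _) => x y z w; ring.
    apply: mulr_ge0; first by rewrite mulr_ge0 // ltW.
    by rewrite subr_ge0 lerXn2r ?nnegrE // ltW.
  rewrite -[_ * _]opprK -mulNr -mulrN !opprB; apply: mulr_ge0.
    by rewrite subr_ge0 (le_trans _ mc) // ler_nat.
  rewrite -(subnK km) !exprD.
  rewrite [X in 0 <= X](_ : _ = t ^+ k * s ^+ k * (t ^+ (m - k) - s ^+ (m - k))); last first.
    by move: (t ^+ k) (s ^+ k) (t ^+ _) (s ^+ _) => x y z w; ring.
  apply: mulr_ge0; first by rewrite mulr_ge0 ?exprn_ge0 // ltW.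
  by rewrite subr_ge0 lerXn2r ?nnegrE // ltW.
rewrite /a'; move: (s ^+ k) (t ^+ k) (s ^+ m) (t ^+ m) (k%:R : R) => x y z w v.
lra.
Qed.

End Derivative.

End PowerSeries.

(** * The point tau *)

Section Tau.
Context {R : realType} (p : nat -> R) (k1 : nat).
Hypothesis p_ge0 : forall k, 0 <= p k.
Hypothesis p_sum1 : (\sum_(0 <= k <oo) (p k)%:E = 1)%E.
Hypothesis p0_gt0 : 0 < p 0%N.
Hypotheses (k1_gt1 : (1 < k1)%N) (pk1_gt0 : 0 < p k1).

(* [K t = t Phi'(t)]; since [K t + p 0 = Phi t + H t], comparing [Psi t] with 1
   amounts to comparing [H t] with [p 0]. *)
Let K : R -> \bar R := pser (fun k => k%:R * p k).
Let H : R -> \bar R := pser (fun k => k.-1%:R * p k).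

Let Kcoef_ge0 k : 0 <= k%:R * p k. Proof. exact: mulr_ge0. Qed.
Let Hcoef_ge0 k : 0 <= k.-1%:R * p k. Proof. exact: mulr_ge0. Qed.

Lemma Phi_pser t : Phi p t = pser p t. Proof. by []. Qed.

Lemma Phi1 : Phi p 1 = 1%E.
Proof. by rewrite /Phi -p_sum1; apply: eq_eseriesr => k _; rewrite expr1n mulr1. Qed.

Lemma Phi_ge0 t : 0 <= t -> (0 <= Phi p t)%E.
Proof. by move=> t0; apply: pser_ge0. Qed.

Lemma le_Phi s t : 0 <= s -> s <= t -> (Phi p s <= Phi p t)%E.
Proof. by move=> s0 st; apply: le_pser. Qed.

Lemma Phi_fineK t : 0 <= t -> (Phi p t < +oo)%E -> (fine (Phi p t))%:E = Phi p t.
Proof. by move=> t0 tfin; rewrite fineK // ge0_fin_numE // Phi_ge0. Qed.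

Lemma fine_Phi_gt0 t : 0 <= t -> (Phi p t < +oo)%E -> 0 < fine (Phi p t).
Proof.
move=> t0 tfin; rewrite -lte_fin Phi_fineK //.
apply: lt_le_trans (pser_term_le p t 0 p_ge0 t0).
by rewrite lte_fin expr0 mulr1.
Qed.

Lemma dPhiE t : 0 <= t -> (t%:E * dPhi p t = K t)%E.
Proof.
move=> t0; rewrite -nneseriesZl; last first.
  by move=> k _; rewrite lee_fin mulr_ge0 ?exprn_ge0.
apply: eq_eseriesr => -[|k] _; first by rewrite !mul0r mule0.
by rewrite -EFinM exprS /=; congr (_%:E); ring.
Qed.

Lemma KD_p0 t : 0 <= t -> (K t + (p 0)%:E = Phi p t + H t)%E.
Proof.
move=> t0; rewrite -(nneseries_single 0 _ (p_ge0 0)) -!nneseriesD.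
- apply: eq_eseriesr => -[|k] _; rewrite -!EFinD; congr (_%:E).
    by rewrite /= expr0; ring.
  by rewrite -natr1 /=; ring.
- by move=> k _ _; rewrite lee_fin mulr_ge0 ?exprn_ge0.
- by move=> k _ _; rewrite lee_fin mulr_ge0 ?exprn_ge0.
- by move=> k _ _; rewrite lee_fin mulr_ge0 ?exprn_ge0.
- by move=> k _ _; rewrite lee_fin mulr_ge0.
Qed.

Lemma H_le_K t : 0 <= t -> (H t <= K t)%E.
Proof.
move=> t0; apply: le_nneseries_fin => k; first by rewrite mulr_ge0 ?exprn_ge0.
by rewrite ler_wpM2r ?exprn_ge0 // ler_wpM2r // ler_nat leq_pred.
Qed.

(** From degree 2 on the coefficients of H dominate those of Phi. *)
Lemma Phi_fin_of_H t : 0 <= t -> (H t < +oo)%E -> (Phi p t < +oo)%E.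
Proof.
move=> t0 Hfin.
apply: (@le_lt_trans _ _ ((p 0)%:E + (p 1 * t)%:E + H t)%E); last first.
  by rewrite lte_add_pinfty // ltry.
rewrite -(nneseries_single 0 _ (p_ge0 0)) -(nneseries_single 1 (p 1 * t)); last first.
  exact: mulr_ge0.
rewrite -!nneseriesD.
- apply: lee_nneseries => k *; rewrite ?lee_fin; first by rewrite mulr_ge0 ?exprn_ge0.
  case: k => [|[|k]] /=.
  + by rewrite !mul0r !addr0 mul1r mulr1.
  + by rewrite !mul0r addr0 add0r mul1r expr1.
  + by rewrite !mul0r !add0r ler_wpM2r ?exprn_ge0 // ler_peMl // ler1n.
- by move=> k _ _; rewrite lee_fin addr_ge0 // mulr_ge0 // mulr_ge0.
- by move=> k _ _; rewrite lee_fin mulr_ge0 ?exprn_ge0.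
- by move=> k _ _; rewrite lee_fin mulr_ge0.
- by move=> k _ _; rewrite lee_fin mulr_ge0 // mulr_ge0.
Qed.

Lemma K_fin s u : 0 <= s -> s < u -> (Phi p u < +oo)%E -> (K s < +oo)%E.
Proof.
move=> s0 su ufin.
have us : 0 < u - s by rewrite subr_gt0.
rewrite -(lte_pmul2l (z := (u - s)%:E)) // gt0_muley ?lte_fin //.
apply: le_lt_trans (pser_deriv_bound _ p_ge0 s u s0 (ltW su)) _.
by rewrite lte_mul_pinfty ?lee_fin.
Qed.

Lemma lt_H s t : 0 <= s -> s < t -> (H s < +oo)%E -> (H s < H t)%E.
Proof.
move=> s0 st Hfin; apply: (lt_pser _ _ _ k1) => //; first exact: ltnW.
by rewrite mulr_gt0 // ltr0n; case: k1 k1_gt1.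
Qed.

(** By convexity H lies below its chord from s to u, which stays under p 0 for a while. *)
Lemma H_right_nbhs s u : 0 <= s -> s < u -> (H s < (p 0)%:E)%E -> (H u < +oo)%E ->
  exists2 t, s < t & (H t <= (p 0)%:E)%E.
Proof.
move=> s0 su Hs Hu.
have Hs0 : (0 <= H s)%E by apply: pser_ge0.
have Hu0 : (0 <= H u)%E by apply: pser_ge0 => //; exact: le_trans (ltW su).
have Hsfin : H s \is a fin_num by rewrite ge0_fin_numE // (lt_trans Hs) // ltry.
have Hufin : H u \is a fin_num by rewrite ge0_fin_numE.
set a := fine (H s); set b := fine (H u).
have aE : H s = a%:E by rewrite fineK.
have bE : H u = b%:E by rewrite fineK.
have b0 : 0 <= b by rewrite -lee_fin -bE.
have ap : a < p 0%N by rewrite -lte_fin -aE.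
have den : 0 < p 0%N - a + b by rewrite ltr_wpDr // subr_gt0.
(* The chord needs e (b - a) <= p 0 - a; enlarging b - a to p 0 - a + b keeps e between 0 and 1. *)
have [e [e0 e1 ee]] : exists e, [/\ 0 < e, e <= 1 & e * (p 0%N - a + b) = p 0%N - a].
  exists ((p 0%N - a) / (p 0%N - a + b)); split; first by rewrite divr_gt0 // subr_gt0.
    by rewrite ler_pdivrMr // mul1r lerDl.
  by rewrite mulfVK // lt0r_neq0.
have us : 0 < u - s by rewrite subr_gt0.
have st : s < s + e * (u - s) by rewrite ltrDl mulr_gt0.
have tu : s + e * (u - s) <= u.
  by rewrite -lerBrDl ler_piMl // ltW.
exists (s + e * (u - s)) => //.
rewrite -(lee_pmul2l (x := (u - s)%:E)) //.
apply: le_trans (pser_convex _ _ _ _ Hcoef_ge0 s0 (ltW st) tu) _.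
rewrite -/(H s) -/(H u) aE bE -!EFinM -EFinD lee_fin.
have -> : u - (s + e * (u - s)) = (u - s) * (1 - e) by ring.
have -> : s + e * (u - s) - s = (u - s) * e by ring.
rewrite -!mulrA -mulrDr ler_wpM2l // ?(ltW us) //.
have a0 : 0 <= a by rewrite -lee_fin -aE.
have : e * (p 0%N - a) >= 0 by rewrite mulr_ge0 ?subr_ge0 // ltW.
have p00 := ltW p0_gt0.
have : e * p 0%N >= 0 by rewrite mulr_ge0 // ltW.
by move: ee; lra.
Qed.

(** If H(tau) < p 0 while Phi were finite somewhere beyond the supremum tau, [H_right_nbhs] would
    contradict its maximality. *)
Lemma tau_exists : exists tau, [/\ 0 < tau, (H tau <= (p 0)%:E)%E,
  forall t, tau < t -> ((p 0)%:E < H t)%E &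
  H tau = (p 0)%:E \/ forall t, tau < t -> Phi p t = +oo%E].
Proof.
pose A := [set t : R | 0 <= t /\ (H t <= (p 0)%:E)%E].
have H0 : H 0 = 0%E.
  by apply: eseries0 => -[|k] _ _; rewrite ?mul0r // expr0n mulr0.
have Afin t : A t -> (H t < +oo)%E.
  by move=> [_ /le_lt_trans]; apply; exact: ltry.
have A_bound t : A t -> t <= p 0%N / p k1 + 1.
  move=> [t0 Ht]; have [t1|t1] := leP t 1.
    by rewrite (le_trans t1) // lerDr divr_ge0.
  rewrite ler_wpDr // ler_pdivlMr //.
  have := le_trans (pser_term_le _ t k1 Hcoef_ge0 t0) Ht; rewrite lee_fin.
  apply: le_trans; rewrite mulrC -mulrA.
  apply: (@le_trans _ _ (p k1 * t ^+ k1)).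
    by rewrite ler_wpM2l // ler_eXnr ?ltW // ltnW.
  rewrite ler_peMl ?mulr_ge0 ?exprn_ge0 // ler1n.
  by case: k1 k1_gt1.
have [t1 t1_gt0 At1] : exists2 t, 0 < t & A t.
  have h0 : (0 : R) < 1 / 2 by lra.
  have H0_lt : (H 0 < (p 0)%:E)%E by rewrite H0 lte_fin.
  have Hh : (H (1 / 2) < +oo)%E.
    apply: le_lt_trans (H_le_K _ (ltW h0)) _.
    by apply: (K_fin _ 1 (ltW h0)); rewrite ?Phi1 ?ltry //; lra.
  have [t t0 Ht] := H_right_nbhs _ _ (lexx 0) h0 H0_lt Hh.
  by exists t => //; split => //; exact: ltW.
have supA : has_sup A.
  by split; [exists t1|exists (p 0%N / p k1 + 1) => t /A_bound].
pose tau := sup A.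
have tau0 : 0 < tau by apply: lt_le_trans t1_gt0 _; exact: ub_le_sup supA.2 _ At1.
have Htau : (H tau <= (p 0)%:E)%E.
  apply: pser_left_closed => // s /andP[s0 stau].
  have [t [t0 Ht] st] := sup_adherent (etrans (subr_gt0 s tau) stau) supA.
  apply: le_trans Ht; apply: le_pser => //; apply: ltW.
  by move: st; rewrite subKr.
have gt_tau t : tau < t -> ((p 0)%:E < H t)%E.
  move=> taut; rewrite ltNge; apply/negP => Ht.
  have At : A t by split => //; rewrite ltW // (lt_trans tau0).
  by move: taut; rewrite ltNge (ub_le_sup supA.2 At).
exists tau; split => //.
have [Heq|Hne] := pselect (H tau = (p 0)%:E); first by left.
right => t taut.
have Hlt : (H tau < (p 0)%:E)%E by rewrite lt_neqAle Htau andbT; apply/eqP.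
apply/eqP; rewrite -leye_eq leNgt; apply/negP => tfin.
pose u := (tau + t) / 2.
have tauu : tau < u by rewrite midf_lt.
have ut : u < t by rewrite midf_lt.
have u0 : 0 <= u by rewrite ltW // (lt_trans tau0).
have Hu : (H u < +oo)%E by rewrite (le_lt_trans (H_le_K _ u0)) // (K_fin _ t).
have [v tauv Hv] := H_right_nbhs _ _ (ltW tau0) tauu Hlt Hu.
by have := gt_tau _ tauv; rewrite ltNge Hv.
Qed.

Lemma K_fin_num s u : 0 <= s -> s < u -> (Phi p u < +oo)%E -> K s \is a fin_num.
Proof.
by move=> s0 su ufin; rewrite ge0_fin_numE ?pser_ge0 //; exact: K_fin ufin.
Qed.

(** * Monotonicity of Psi and its limits at the radius of convergence *)

Lemma PsiE t : 0 <= t -> Psi p t = (K t * ((fine (Phi p t))^-1)%:E)%E.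
Proof. by move=> t0; rewrite /Psi dPhiE. Qed.

Lemma Psi_ge1 t : 0 <= t -> (Phi p t < +oo)%E ->
  (1 <= Psi p t)%E = ((p 0)%:E <= H t)%E.
Proof.
move=> t0 tfin; rewrite PsiE // lee_pdivlMr ?fine_Phi_gt0 // mul1e Phi_fineK //.
by rewrite -(@leeD2rE _ (p 0)%:E) // KD_p0 // leeD2lE // ge0_fin_numE ?Phi_ge0.
Qed.

Lemma Psi_le1 t : 0 <= t -> (Phi p t < +oo)%E ->
  (Psi p t <= 1)%E = (H t <= (p 0)%:E)%E.
Proof.
move=> t0 tfin; rewrite PsiE // lee_pdivrMr ?fine_Phi_gt0 // mul1e Phi_fineK //.
by rewrite -(@leeD2rE _ (p 0)%:E) // KD_p0 // leeD2lE // ge0_fin_numE ?Phi_ge0.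
Qed.

Lemma Psi_eq1 t : 0 <= t -> (Phi p t < +oo)%E ->
  Psi p t = 1%E <-> H t = (p 0)%:E.
Proof.
move=> t0 tfin; split=> /eqP; rewrite eq_le => /andP[le ge]; apply/eqP.
  by rewrite eq_le -Psi_le1 // -Psi_ge1 // le.
by rewrite eq_le Psi_le1 // Psi_ge1 // le.
Qed.

Lemma Psi1 : Psi p 1 = xi_mean p.
Proof. by rewrite /Psi Phi1 /= invr1 mule1 mul1e. Qed.

Lemma Psi_ge0 t : 0 <= t -> (0 <= Psi p t)%E.
Proof.
move=> t0; rewrite PsiE // mule_ge0 ?pser_ge0 // lee_fin invr_ge0.
by rewrite fine_ge0 // Phi_ge0.
Qed.

Lemma le_Psi s t : 0 <= s -> s <= t -> (Phi p t < +oo)%E -> (Psi p s <= Psi p t)%E.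
Proof.
move=> s0 st tfin; have t0 := le_trans s0 st.
move: st; rewrite le_eqVlt => /predU1P[-> //|st].
move: s0; rewrite le_eqVlt => /predU1P[<-|s_gt0].
  by rewrite {1}/Psi !mul0e Psi_ge0.
have s0 := ltW s_gt0; have sfin := le_lt_trans (le_Phi _ _ s0 (ltW st)) tfin.
have Ks := K_fin_num _ _ s0 st tfin.
pose c := fine (K s) / fine (Phi p s).
have c0 : 0 <= c by rewrite divr_ge0 ?fine_ge0 ?pser_ge0 ?Phi_ge0.
have -> : Psi p s = c%:E by rewrite PsiE // EFinM fineK.
rewrite PsiE // lee_pdivlMr ?fine_Phi_gt0 // Phi_fineK //.
apply: (pser_logderiv_mono _ p_ge0 s) => //; first exact: ltW.
rewrite -[pser p s]Phi_fineK // -EFinM /c mulfVK ?fineK //.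
by rewrite lt0r_neq0 // fine_Phi_gt0.
Qed.

Lemma le_xi_rho t : 0 <= t -> (Phi p t < +oo)%E -> (t%:E <= xi_rho p)%E.
Proof. by move=> t0 tfin; apply: ereal_sup_ubound; exists t. Qed.

Lemma Phi_fin_lt_rho t : 0 <= t -> (t%:E < xi_rho p)%E -> (Phi p t < +oo)%E.
Proof.
move=> t0 /ereal_sup_gt[_ [u [u0 ufin] <-]]; rewrite lte_fin => tu.
by apply: le_lt_trans ufin; apply: le_Phi => //; exact: ltW.
Qed.

Lemma xi_rho_ge1 : (1 <= xi_rho p)%E.
Proof. by apply: le_xi_rho; rewrite ?Phi1 ?ltry. Qed.

Lemma Psi_cvg_at_left r : 0 < r -> xi_rho p = r%:E -> cvg (Psi p t @[t --> r^'-]).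
Proof.
move=> r0 rho; apply: (nondecreasing_at_left_is_cvge _ r 0 r0) => s t.
rewrite !in_itv /= => /andP[s0 _] /andP[t0 tr] st; apply: le_Psi => //.
  exact: ltW.
by apply: Phi_fin_lt_rho; rewrite ?rho // ltW.
Qed.

Lemma Psi_cvg_pinfty : xi_rho p = +oo%E -> cvg (Psi p t @[t --> +oo%R]).
Proof.
(* Monotonicity is available for nonnegative arguments; cutting off at 0 extends it to the line and
   keeps the limit at infinity. *)
move=> rho; pose f t := Psi p (Num.max t 0).
have fcvg : cvg (f t @[t --> +oo%R]).
  apply: nondecreasing_is_cvge => s t st; apply: le_Psi.
  - by rewrite le_max lexx orbT.
  - by rewrite ge_max !le_max st lexx !orbT.
  - by apply: Phi_fin_lt_rho; rewrite ?rho ?ltry // le_max lexx orbT.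
move/cvg_ex : fcvg => [l fl]; apply/cvg_ex; exists l.
apply: cvg_trans fl; apply: near_eq_cvg; near=> t.
by rewrite /f max_l //; near: t; exact: nbhs_pinfty_ge.
Unshelve. all: by end_near. Qed.

(** * Characterization of tau and minimality of Phi(t) / t there *)

Section CriticalPoint.
Variable tau : R.
Hypothesis tau_gt0 : 0 < tau.
Hypothesis H_tau : (H tau <= (p 0)%:E)%E.
Hypothesis H_gt_tau : forall t, tau < t -> ((p 0)%:E < H t)%E.
Hypothesis tau_cases : H tau = (p 0)%:E \/ forall t, tau < t -> Phi p t = +oo%E.

Let tau_ge0 : 0 <= tau := ltW tau_gt0.

Lemma H_tau_fin : (H tau < +oo)%E.
Proof. by apply: le_lt_trans H_tau _; exact: ltry. Qed.

Lemma Phi_tau_fin : (Phi p tau < +oo)%E.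
Proof. by apply: Phi_fin_of_H => //; exact: H_tau_fin. Qed.

Lemma H_lt_tau t : 0 <= t -> t < tau -> (H t < (p 0)%:E)%E.
Proof.
move=> t0 tt; apply: lt_le_trans H_tau; apply: lt_H => //.
by apply: le_lt_trans H_tau_fin; apply: le_pser => //; exact: ltW.
Qed.

Lemma H_eq_tau t : 0 <= t -> H t = (p 0)%:E -> t = tau.
Proof.
move=> t0 Ht; have [tt|tt|//] := ltgtP t tau.
  by have := H_lt_tau _ t0 tt; rewrite Ht ltxx.
by have := H_gt_tau _ tt; rewrite Ht ltxx.
Qed.

Lemma xi_nu_ge1 : H tau = (p 0)%:E -> (1 <= xi_nu p)%E.
Proof.
move=> Htau; have tau_rho := le_xi_rho _ tau_ge0 Phi_tau_fin.
have Psi_tau : Psi p tau = 1%E by apply/Psi_eq1 => //; exact: Phi_tau_fin.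
rewrite /xi_nu; case rhoE : (xi_rho p) => [r| |].
- have tr : tau <= r by rewrite -lee_fin -rhoE.
  case: ifPn => rfin; first by rewrite -Psi_tau le_Psi.
  have {}tr : tau < r.
    rewrite lt_neqAle tr andbT; apply: contraNneq rfin => <-.
    exact: Phi_tau_fin.
  apply: lime_ge; first by apply: Psi_cvg_at_left => //; exact: lt_trans tr.
  near=> t; have tt : tau <= t by near: t; exact: nbhs_left_ge.
  rewrite -Psi_tau le_Psi // Phi_fin_lt_rho ?(le_trans tau_ge0) // rhoE lte_fin.
  by near: t; exact: nbhs_left_lt.
- apply: lime_ge; first exact: Psi_cvg_pinfty.
  near=> t; have tt : tau <= t by near: t; apply: nbhs_pinfty_ge; rewrite num_real.
  by rewrite -Psi_tau le_Psi // Phi_fin_lt_rho ?(le_trans tau_ge0) // rhoE ltry.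
- by have := xi_rho_ge1; rewrite rhoE.
Unshelve. all: by end_near. Qed.

Lemma xi_rho_tau : (forall t, tau < t -> Phi p t = +oo%E) -> xi_rho p = tau%:E.
Proof.
move=> inf_gt; apply/eqP; rewrite eq_le le_xi_rho ?Phi_tau_fin // andbT.
apply: ge_ereal_sup => _ [t [t0 tfin] <-]; rewrite lee_fin leNgt.
by apply/negP => /inf_gt tinf; rewrite tinf ltxx in tfin.
Qed.

(** Here tau is the radius of convergence and Phi(tau) is finite, so nu is the value Psi(tau) and
    not a limit. *)
Lemma xi_nu_lt1 : H tau != (p 0)%:E -> (xi_nu p < 1)%E /\ xi_rho p = tau%:E.
Proof.
move=> Hne; have Phi_inf : forall t, tau < t -> Phi p t = +oo%E.
  by case: tau_cases => // Heq; rewrite Heq eqxx in Hne.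
have rho := xi_rho_tau Phi_inf; split => //.
rewrite /xi_nu rho Phi_tau_fin ltNge Psi_ge1 //; last exact: Phi_tau_fin.
by rewrite -ltNge lt_neqAle Hne.
Qed.

Lemma tau_spec_tau : tau_spec p tau.
Proof.
have [Heq|Hne] := eqVneq (H tau) (p 0)%:E; last first.
  by right; have [] := xi_nu_lt1 Hne.
left; split; first exact: xi_nu_ge1.
split => //; split; first exact: le_xi_rho Phi_tau_fin.
by split; [exact: Phi_tau_fin|apply/Psi_eq1 => //; exact: Phi_tau_fin].
Qed.

Lemma tau_spec_unique t : tau_spec p t -> t = tau.
Proof.
case=> [[_ [t0 [_ [tfin /Psi_eq1 Ht]]]]|[nu_lt1 rhoE]].
  by apply: H_eq_tau => //; exact: Ht.
have [Heq|/xi_nu_lt1[_]] := eqVneq (H tau) (p 0)%:E.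
  by have := xi_nu_ge1 Heq; rewrite leNgt nu_lt1.
by rewrite -rhoE => -[].
Qed.

Local Notation phi := (fine (Phi p tau)).

(** This is tau Phi'(tau), finite even at the radius of convergence because K + p 0 = Phi + H. *)
Let kap := fine (K tau).

Lemma K_tau : K tau = kap%:E.
Proof.
rewrite fineK // ge0_fin_numE ?pser_ge0 //.
apply: (@le_lt_trans _ _ (K tau + (p 0)%:E)%E); first by rewrite leeDl ?lee_fin.
by rewrite KD_p0 // lte_add_pinfty ?Phi_tau_fin ?H_tau_fin.
Qed.

Lemma kap_le : kap <= phi.
Proof.
rewrite -lee_fin -K_tau Phi_fineK ?Phi_tau_fin //.
by rewrite -(@leeD2rE _ (p 0)%:E) // KD_p0 // leeD2l.
Qed.

(* [(t - tau) (phi - kap) <= 0], as [kap = phi] when [t > tau]. *)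
Lemma kap_phi t : (Phi p t < +oo)%E -> (t - tau) * (phi - kap) <= 0.
Proof.
move=> tfin; have [tt|tt] := leP t tau.
  by rewrite mulr_le0_ge0 // ?subr_le0 // subr_ge0 kap_le.
apply: mulr_ge0_le0; first by rewrite subr_ge0 ltW.
rewrite subr_le0.
have Heq : H tau = (p 0)%:E.
  by case: tau_cases => // /(_ _ tt) tinf; rewrite tinf ltxx in tfin.
rewrite -lee_fin -K_tau Phi_fineK ?Phi_tau_fin //.
by rewrite -(@leeD2rE _ (p 0)%:E) // KD_p0 // Heq.
Qed.

(** The tangent at tau gives tau Phi(t) >= t phi - (t - tau) (phi - kap), and [kap_phi] controls the
    last product. *)
Lemma Phi_tau_min t : 0 <= t -> ((phi * t)%:E <= tau%:E * Phi p t)%E.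
Proof.
move=> t0; have [tfin|] := ltP (Phi p t) +oo%E; last first.
  by rewrite leye_eq => /eqP ->; rewrite gt0_muley ?lte_fin // leey.
have := pser_tangent _ p_ge0 tau t tau_ge0 t0.
rewrite -/(K tau) K_tau -!Phi_pser -(Phi_fineK _ t0 tfin).
rewrite -(Phi_fineK _ tau_ge0 Phi_tau_fin) -!EFinM -!EFinD !lee_fin /=.
by have := kap_phi _ tfin; nra.
Qed.

(** The strict tangent inequality is evaluated at t = 1, where Phi is 1. *)
Lemma phi_lt_tau : tau != 1 -> phi < tau.
Proof.
move=> tau1; have Phi1fin : (Phi p 1 < +oo)%E by rewrite Phi1 ltry.
have := pser_tangent_lt _ p_ge0 tau 1 k1 tau_gt0 ler01.
rewrite eq_sym => /(_ tau1 k1_gt1 pk1_gt0 Phi_tau_fin).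
rewrite -/(K tau) K_tau => /(_ (ltry _)).
rewrite -!Phi_pser Phi1 mule1 mul1e -(Phi_fineK _ tau_ge0 Phi_tau_fin).
rewrite -!EFinM -!EFinD !lte_fin /=.
by have := kap_phi _ Phi1fin; nra.
Qed.

Lemma phi_tau1 : tau = 1 -> phi = 1.
Proof. by move=> ->; rewrite Phi1. Qed.

(** The mean is Psi(1), so its position relative to 1 is that of H(1) relative to p 0. *)
Lemma subcritical_tau_ge1 : (xi_mean p < 1)%E -> 1 <= tau.
Proof.
rewrite -Psi1 ltNge Psi_ge1 ?Phi1 ?ltry // -ltNge leNgt => Hlt.
by apply/negP => /H_gt_tau Hgt; have := lt_trans Hlt Hgt; rewrite ltxx.
Qed.

Lemma supercritical_tau_lt1 : (1 < xi_mean p)%E -> tau < 1.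
Proof.
rewrite -Psi1 ltNge Psi_le1 ?Phi1 ?ltry // -ltNge => Hgt.
rewrite ltNge le_eqVlt; apply/negP => /predU1P[one_tau|]; last first.
  by move=> /(H_lt_tau _ ler01) Hlt; have := lt_trans Hlt Hgt; rewrite ltxx.
by move: Hgt; rewrite one_tau ltNge H_tau.
Qed.

Lemma critical_tau_eq1 : xi_mean p = 1%E -> tau = 1.
Proof.
rewrite -Psi1 => /Psi_eq1; rewrite Phi1 => /(_ ler01 (ltry _)) H1.
by rewrite -(H_eq_tau _ ler01 H1).
Qed.

Lemma subcritical_tau_eq1 : (xi_mean p < 1)%E -> xi_rho p = 1%E -> tau = 1.
Proof.
move=> /subcritical_tau_ge1 tau1 rho; apply: le_anti; rewrite tau1 andbT -lee_fin -rho.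
exact: le_xi_rho Phi_tau_fin.
Qed.

(** If tau were 1, then H(tau) < p 0 would force the radius of convergence to be 1. *)
Lemma subcritical_tau_gt1 : (xi_mean p < 1)%E -> (1 < xi_rho p)%E -> 1 < tau.
Proof.
move=> mean rho; rewrite lt_neqAle subcritical_tau_ge1 // andbT; apply/eqP => tau1.
have Hne : H tau != (p 0)%:E.
  move: mean; rewrite -Psi1 ltNge Psi_ge1 ?Phi1 ?ltry // -ltNge -tau1.
  by rewrite lt_neqAle => /andP[].
by move: rho; rewrite (xi_nu_lt1 Hne).2 -tau1 ltxx.
Qed.

End CriticalPoint.
End Tau.

(** * Growth rate phi / tau and comparison of tau with 1 *)

Theorem theorem17p7 (R : realType) (p : nat -> R)
  (p_ge0 : forall k, 0 <= p k)
  (p_sum1 : (\sum_(0 <= k <oo) (p k)%:E = 1)%E)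
  (p0_gt0 : 0 < p 0%N)
  (p_gt1 : exists k, (1 < k)%N /\ 0 < p k) :
  exists tau : R,
    tau_spec p tau /\ (forall tau', tau_spec p tau' -> tau' = tau) /\
    exists L : R,
      (* P(|T| = n) > 0 for all large n = 1 mod xi_span *)
      (\forall k \near \oo,
          0 < gw_size_prob p (k * xi_span p + 1)) /\
      (* (1/n) log P(|T| = n) -> L along n = 1 mod xi_span *)
      ((fun k : nat => ln (gw_size_prob p (k * xi_span p + 1))
                       / (k * xi_span p + 1)%:R) @ \oo --> L) /\
      (Phi p tau < +oo)%E /\
      L = ln (fine (Phi p tau)) - ln tau /\
      ereal_inf [set (Phi p t * (t^-1)%:E)%E | t in [set t : R | 0 < t]]
        = (expR L)%:E /\
      L <= 0 /\
      ((xi_mean p = 1%E \/ ((xi_mean p < 1)%E /\ xi_rho p = 1%E)) -> L = 0) /\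
      (~ (xi_mean p = 1%E \/ ((xi_mean p < 1)%E /\ xi_rho p = 1%E)) -> L < 0) /\
      ((1 < xi_mean p)%E -> tau < 1) /\
      ((xi_mean p < 1)%E -> (1 < xi_rho p)%E -> 1 < tau) /\
      ((xi_mean p = 1%E \/ ((xi_mean p < 1)%E /\ xi_rho p = 1%E)) -> tau = 1).
Proof.
have [k1 [k1_gt1 pk1_gt0]] := p_gt1.
have [tau [tau_gt0 H_tau H_gt_tau tau_cases]] :=
  tau_exists p k1 p_ge0 p_sum1 p0_gt0 k1_gt1 pk1_gt0.
have tau_fin := Phi_tau_fin p p_ge0 tau tau_gt0 H_tau.
have tau_min := Phi_tau_min p p_ge0 tau tau_gt0 H_tau tau_cases.
have phi_gt0 := fine_Phi_gt0 p p_ge0 p0_gt0 tau (ltW tau_gt0) tau_fin.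
have phiE := Phi_fineK p p_ge0 tau (ltW tau_gt0) tau_fin.
set phi := fine (Phi p tau) in tau_min phi_gt0 phiE.
have lam_gt0 : 0 < phi / tau by rewrite divr_gt0.
have LE : ln phi - ln tau = ln (phi / tau) by rewrite ln_div ?posrE.
have tau_eq1 : xi_mean p = 1%E \/ ((xi_mean p < 1)%E /\ xi_rho p = 1%E) -> tau = 1.
  case=> [|[mean rho]]; first exact: (critical_tau_eq1 p k1).
  exact: (subcritical_tau_eq1 p).
have gt1 : (1 < xi_mean p)%E -> tau < 1 by exact: (supercritical_tau_lt1 p k1).
have lt1 : (xi_mean p < 1)%E -> (1 < xi_rho p)%E -> 1 < tau.
  exact: (subcritical_tau_gt1 p).
have lam_eq1 : tau = 1 -> phi / tau = 1.
  by move=> tau1; rewrite /phi (phi_tau1 p p_sum1 tau tau1) tau1 divr1.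
have lam_lt1 : tau != 1 -> phi / tau < 1.
  move=> tau1; rewrite ltr_pdivrMr // mul1r.
  exact: (phi_lt_tau p k1 p_ge0 p_sum1 k1_gt1 pk1_gt0 tau tau_gt0 H_tau tau_cases).
have tau_ne1 :
    ~ (xi_mean p = 1%E \/ ((xi_mean p < 1)%E /\ xi_rho p = 1%E)) -> tau != 1.
  move=> ncond; apply/negP => /eqP tau1.
  have [mean|mean|mean] := ltgtP (xi_mean p) 1%E.
  - have := xi_rho_ge1 p p_sum1; rewrite le_eqVlt => /predU1P[rho|rho].
      by apply: ncond; right.
    by have := lt1 mean rho; rewrite tau1 ltxx.
  - by have := gt1 mean; rewrite tau1 ltxx.
  - by apply: ncond; left.
have [K qK] : exists K, forall k, (K <= k)%N -> 0 < gw_size_prob p (k * xi_span p + 1).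
  by apply: gw_size_prob_gt0 => //; exists k1 => //; exact: ltnW.
have span_gt0 : (0 < xi_span p)%N.
  have [|_ span_max] := xi_spanP p; first by exists k1 => //; exact: ltnW.
  by apply: span_max => k _; exact: dvd1n.
exists tau; split; first exact: (tau_spec_tau p).
split; first exact: (tau_spec_unique p k1).
exists (ln (phi / tau)); split; first by exists K.
split.
  apply: (gw_size_prob_growth p p_ge0 p0_gt0 _ tau _ _ _ _ _ K) => //.
  - move=> N; rewrite mulfVK ?lt0r_neq0 // -lee_fin phiE.
    exact: pser_trunc_le p_ge0 (ltW tau_gt0).
  (* Combine phi t <= tau Phi(t) with Phi(t) <= c t and cancel t. *)
  - move=> t c t_gt0 Pt; have t_ge0 := ltW t_gt0.
    have := tau_min _ t_ge0; rewrite ler_pdivrMr //.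
    have Phi_c : (Phi p t <= (c * t)%:E)%E by exact: pser_le.
    move=> /le_trans => /(_ (tau%:E * (c * t)%:E)%E).
    rewrite lee_pmul2l // => /(_ Phi_c); rewrite -EFinM lee_fin.
    by rewrite mulrA ler_pM2r // mulrC.
split=> //; split=> //; split.
  rewrite lnK ?posrE //; apply/eqP; rewrite eq_le; apply/andP; split.
    by apply: ereal_inf_lbound; exists tau => //; rewrite -phiE EFinM.
  apply: le_ereal_inf_tmp => _ [t t_gt0 <-].
  rewrite lee_pdivlMr // -(lee_pmul2l (x := tau%:E)) //.
  have := tau_min t (ltW t_gt0).
  by rewrite -!EFinM (_ : tau * (phi / tau * t) = phi * t) //; field; rewrite lt0r_neq0.
split.
  by have [/lam_eq1 ->|/lam_lt1 /ltW] := eqVneq tau 1; [rewrite ln1|exact: ln_le0].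
split; first by move=> /tau_eq1 /lam_eq1 ->; rewrite ln1.
by split=> // /tau_ne1 /lam_lt1 lam_lt1'; rewrite ln_lt0 // lam_gt0.
Qed.
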